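(* Let $F_1,F_2,\dots,F_n$ be conic Finsler metrics on a manifold $M$ defined on the same conic domain $A$. Then $F=F_1+F_2+\dots+F_n$ is also a conic Finsler metric (with domain $A$) and its fundamental tensor $g$ is given by $$g_v(w,w)=F(v)\sum_{k=1}^n\frac{h^k_v(w,w)}{F_k(v)}+\Big(\sum_{k=1}^n\frac{g^k_v(v,w)}{F_k(v)}\Big)^2$$ for any $v\in A\setminus0$ and $w\in T_{\pi(v)}M$, where $g^k$ and $h^k$ are the fundamental tensor and the angular metric of $F_k$.
   Context: Let $\pi:TM\to M$ be the natural projection. A conic Finsler metric on $M$ with conic domain $A$ is a continuous function $F:A\to[0,\infty)$, where $A\subset TM$ is open with $\pi(A)=M$ and conic ($v\in A$, $\lambda>0$ imply $\lambda v\in A$), which is smooth on $A$ except at most at the zero vectors, with $F(v)=0$ iff $v$ is a zero vector, $F(\lambda v)=\lambda F(v)$ for $\lambda>0$, $v\in A$, and whose fundamental tensor $g_v(u,w)=\frac12\frac{\partial^2}{\partial t\partial s}F(v+tu+sw)^2|_{t=s=0}$ ($u,w\in T_{\pi(v)}M$) is positive definite for all $v\in A\setminus0$ (nonzero vectors of $A$). The angular metric of $F_k$ is $h^k_v(w,w)=g^k_v(w,w)-\frac{1}{F_k(v)^2}g^k_v(v,w)^2$. *)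

(* Defs.v *)
From HB Require Import structures.
From mathcomp Require Import all_boot all_order all_algebra.
From mathcomp Require Import all_classical all_reals all_analysis.

Set Implicit Arguments.
Unset Strict Implicit.
Unset Printing Implicit Defensive.

Import Order.TTheory GRing.Theory Num.Theory.
Import numFieldNormedType.Exports.

Local Open Scope classical_set_scope.
Local Open Scope ring_scope.

Section smoothness.
Variables (R : realType) (V W : normedModType R).

(* Meant for finite-dimensional V and open U: there the differential of f is
   C^k exactly when each directional derivative 'D_v f is. *)
Fixpoint Ck_on (k : nat) (U : set V) (f : V -> W) : Prop :=
  match k with
  | 0%N => {within U, continuous f}
  | k'.+1 => (forall x, U x -> differentiable f x) /\
             forall v : V, Ck_on k' U ('D_v f)
  end.

Definition smooth_on (U : set V) (f : V -> W) := forall k, Ck_on k U f.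

End smoothness.

(* The atlas need not be maximal.  [chart i] and [chart_inv i] are total
   functions, meaningful only on [dom i] and on its image. *)
Record smoothManifold (R : realType) (m : nat) := SmoothManifold {
  space :> topologicalType ;
  manifold_hausdorff : hausdorff_space space ;
  manifold_second_countable : @second_countable space ;
  atlas : Type ;
  dom : atlas -> set space ;
  chart : atlas -> space -> 'rV[R]_m ;
  chart_inv : atlas -> 'rV[R]_m -> space ;
  dom_open : forall i, open (dom i) ;
  dom_cover : forall p, exists i, dom i p ;
  chart_open : forall i, open (chart i @` dom i) ;
  chartK : forall i p, dom i p -> chart_inv i (chart i p) = p ;
  chart_continuous : forall i, {within dom i, continuous (chart i)} ;
  chart_inv_continuous :
    forall i, {within chart i @` dom i, continuous (chart_inv i)} ;
  transition_smooth : forall i j,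
    smooth_on (chart i @` (dom i `&` dom j)) (chart j \o chart_inv i)
}.

Section tangent_space.
Variables (R : realType) (m : nat) (M : smoothManifold R m).

(* A tangent vector at p is the family of its coordinate vectors in the charts
   around p, related by the differentials of the transition maps; the entries
   at the charts whose domain misses p carry no information and are set to 0. *)
Definition is_tangent (p : M) (c : atlas M -> 'rV[R]_m) : Prop :=
  (forall i, ~ dom i p -> c i = 0) /\
  (forall i j, dom i p -> dom j p ->
     c j = 'd (chart j \o chart_inv i) (chart i p) (c i)).

Definition tangent_pred (p : M) : pred (atlas M -> 'rV[R]_m) :=
  fun c => `[< is_tangent p c >].

Record tangentSpace (p : M) := Tangent {
  tcoord : atlas M -> 'rV[R]_m ;
  tcoordP : tangent_pred p tcoord
}.

HB.instance Definition _ (p : M) := [isSub for @tcoord p].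
HB.instance Definition _ (p : M) := [Choice of tangentSpace p by <:].

Lemma tangent_pred_closed (p : M) :
  GRing.subsemimod_closed (tangent_pred p).
Proof.
split; first split.
- by apply/asboolP; split=> // i j _ _; rewrite linear0.
- move=> u v /asboolP[u0 uE] /asboolP[v0 vE]; apply/asboolP; split.
    by move=> i ip; rewrite /= !fctE u0// v0// addr0.
  by move=> i j ip jp; rewrite /= !fctE (uE i j)// (vE i j)// linearD.
- move=> a v /asboolP[v0 vE]; apply/asboolP; split.
    by move=> i ip; rewrite /= !fctE v0// scaler0.
  by move=> i j ip jp; rewrite /= !fctE (vE i j)// linearZ.
Qed.

HB.instance Definition _ (p : M) :=
  GRing.SubChoice_isSubLmodule.Build R (atlas M -> 'rV[R]_m) (tangent_pred p)
    (tangentSpace p) (@tangent_pred_closed p).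

Lemma chart_overlap_nbhs i j (p : M) : dom i p -> dom j p ->
  \forall x \near chart i p, dom i (chart_inv i x) /\ dom j (chart_inv i x).
Proof.
move=> ip jp.
have ci : {for chart i p, continuous (chart_inv (s := M) i)}.
  have := @chart_inv_continuous _ _ M i.
  rewrite continuous_open_subspace; last exact: chart_open.
  by apply; apply/mem_set; exists p.
have := ci (dom i `&` dom j); apply; rewrite chartK//.
by apply: open_nbhs_nbhs; split=> //; apply: openI; exact: dom_open.
Qed.

Lemma transition_differentiable i j (p : M) : dom i p -> dom j p ->
  differentiable (chart j \o chart_inv i) (chart i p).
Proof.
move=> ip jp; have [+ _] := @transition_smooth _ _ M i j 1%N.
by apply; exists p.
Qed.

Lemma transition_cocycle i j k (p : M) (y : 'rV[R]_m) :
  dom i p -> dom j p -> dom k p ->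
  'd (chart k \o chart_inv i) (chart i p) y =
  'd (chart k \o chart_inv j) (chart j p)
    ('d (chart j \o chart_inv i) (chart i p) y).
Proof.
move=> ip jp kp.
have dij := transition_differentiable ip jp.
have dik := transition_differentiable ip kp.
have djk := transition_differentiable jp kp.
have E : (chart j \o chart_inv i) (chart i p) = chart j p by rewrite /= chartK.
have djk' : differentiable (chart k \o chart_inv j)
  ((chart j \o chart_inv i) (chart i p)) by rewrite E.
have dc := differentiable_comp dij djk'.
have D : 'D_y (chart k \o chart_inv i) (chart i p) =
         'D_y ((chart k \o chart_inv j) \o (chart j \o chart_inv i)) (chart i p).
  apply: near_eq_derive.
  near=> x; have [_ jx] : dom i (chart_inv i x) /\ dom j (chart_inv i x).
    by near: x; exact: chart_overlap_nbhs.
  by rewrite /= chartK.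
have C := congr1 (@^~ y) (diff_comp dij djk').
rewrite E in C.
exact: etrans (esym (deriveE y dik)) (etrans D (etrans (deriveE y dc) C)).
Unshelve. all: by end_near. Qed.

Definition coord_family (i : atlas M) (p : M) (y : 'rV[R]_m) :
    atlas M -> 'rV[R]_m :=
  fun j => if `[< dom i p /\ dom j p >]
           then 'd (chart j \o chart_inv i) (chart i p) y else 0.

Lemma coord_familyP i p y : tangent_pred p (coord_family i p y).
Proof.
apply/asboolP; split=> [j jp|j k jp kp]; rewrite /coord_family.
  by case: asboolP => // -[].
case: asboolP => [[ip _]|nik]; case: asboolP => [[ip' _]|nij].
- exact: transition_cocycle.
- by case: nij.
- by case: nik; split.
- by rewrite linear0.
Qed.

(* The vector of T_pM whose coordinate vector in the chart i is y (0 if p is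
   not in the domain of i). *)
Definition tangent_of_coord (i : atlas M) (p : M) (y : 'rV[R]_m) :
  tangentSpace p := Tangent (coord_familyP i p y).

Lemma tangent_of_coordK i p y : dom i p -> tcoord (tangent_of_coord i p y) i = y.
Proof.
move=> ip; rewrite /= /coord_family; case: asboolP => [_|[]//].
rewrite -deriveE; last exact: transition_differentiable.
have [->|y0] := eqVneq y 0.
  by rewrite deriveE ?linear0//; exact: transition_differentiable.
have -> : 'D_y (chart i \o chart_inv i) (chart i p) = 'D_y id (chart i p).
  apply: near_eq_derive => //; have oi := @chart_open _ _ M i.
  have : nbhs (chart i p) (chart i @` dom i).
    by apply: open_nbhs_nbhs; split=> //; exists p.
  by apply: filterS => _ [q iq <-] /=; rewrite chartK.
by rewrite derive_id.
Qed.

Record tangentBundle := TVec { base : M ; vec : tangentSpace base }.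

HB.instance Definition _ := gen_eqMixin tangentBundle.
HB.instance Definition _ := gen_choiceMixin tangentBundle.

Definition tdom (i : atlas M) : set tangentBundle := [set v | dom i (base v)].

Definition tchart (i : atlas M) (v : tangentBundle) : 'rV[R]_m * 'rV[R]_m :=
  (chart i (base v), tcoord (vec v) i).

Definition tchart_inv (i : atlas M) (z : 'rV[R]_m * 'rV[R]_m) : tangentBundle :=
  TVec (tangent_of_coord i (chart_inv i z.1) z.2).

Lemma tchartK i v : tdom i v -> tchart_inv i (tchart i v) = v.
Proof.
case: v => p [c cP] ip; rewrite /tchart_inv /= chartK//; congr TVec.
apply: val_inj; apply/funext => j /=; rewrite /coord_family.
have /asboolP[c0 cE] := cP.
by case: asboolP => [[_ jp]|nij]; [rewrite -cE | rewrite c0//; tauto].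
Qed.

Lemma tchart_invK i z :
  (chart i @` dom i) z.1 -> tchart i (tchart_inv i z) = z.
Proof.
case: z => x y /= [p ip <-{x}]; rewrite /tchart_inv /tchart /=.
by rewrite -[coord_family _ _ _]/(tcoord (tangent_of_coord _ _ _)) chartK//
  tangent_of_coordK.
Qed.

Lemma tchart_image i (O : set tangentBundle) : tchart i @` (O `&` tdom i) =
  [set z | (chart i @` dom i) z.1 /\ O (tchart_inv i z)].
Proof.
apply/seteqP; split=> [_ [v [Ov iv] <-]|z [iz Oz]] /=.
  by rewrite tchartK//; split=> //; exists (base v).
exists (tchart_inv i z); last exact: tchart_invK.
by split=> //; case: iz => p ip /= E; rewrite /tdom /= -E chartK.
Qed.

(* The topology of TM making every bundle chart a homeomorphism. *)
Definition tangent_open (O : set tangentBundle) :=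
  forall i, open (tchart i @` (O `&` tdom i)).

Lemma tangent_openT : tangent_open setT.
Proof.
move=> i; rewrite tchart_image.
have -> : [set z | (chart i @` dom i) z.1 /\ [set: tangentBundle] (tchart_inv i z)]
    = fst @^-1` (chart i @` dom i) by apply/seteqP; split=> z //= [].
apply: open_comp; last exact: chart_open.
by move=> z _; exact: cvg_fst.
Qed.

Lemma tangent_openI : setI_closed tangent_open.
Proof.
move=> O P oO oP i; have := openI (oO i) (oP i); rewrite !tchart_image.
by congr open; apply/seteqP; split=> z /=; tauto.
Qed.

Lemma tangent_open_bigU (I : Type) (f : I -> set tangentBundle) :
  (forall k, tangent_open (f k)) -> tangent_open (\bigcup_k f k).
Proof.
move=> of_ i; rewrite setI_bigcupl image_bigcup.
by apply: bigcup_open => k _; exact: of_.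
Qed.

HB.instance Definition _ := isOpenTopological.Build tangentBundle
  tangent_openT tangent_openI tangent_open_bigU.

End tangent_space.

Section conic_finsler.
Variables (R : realType) (m : nat) (M : smoothManifold R m).
Local Notation TM := (tangentBundle M).

Definition tscale (a : R) (v : TM) : TM := TVec (a *: vec v).

Definition nonzero_part (A : set TM) : set TM := [set v | A v /\ vec v != 0].

Definition smooth_on_TM (O : set TM) (F : TM -> R) : Prop :=
  forall i, smooth_on (tchart i @` (O `&` @tdom _ _ M i))
                      (F \o @tchart_inv _ _ M i : _ -> R^o).

Definition fundamental_tensor (F : TM -> R) (v : TM)
    (u w : tangentSpace (base v)) : R :=
  2^-1 * derive1 (fun t : R =>
    derive1 (fun s : R => F (TVec (vec v + t *: u + s *: w)) ^+ 2) 0) 0.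

Definition angular_metric (F : TM -> R) (v : TM)
    (w : tangentSpace (base v)) : R :=
  fundamental_tensor F w w
  - (F v ^+ 2)^-1 * fundamental_tensor F (vec v) w ^+ 2.

Definition conic_domain (A : set TM) : Prop :=
  [/\ open A,
      @base _ _ M @` A = [set: M]
    & forall (v : TM) (a : R), A v -> 0 < a -> A (tscale a v)].

(* F is a total function, of which only the values on A matter: A is open and
   so contains all points near v used by [fundamental_tensor]. *)
Record conic_finsler_metric (A : set TM) (F : TM -> R) : Prop :=
  ConicFinslerMetric {
  cfm_domain : conic_domain A ;
  cfm_ge0 : forall v, A v -> 0 <= F v ;
  cfm_continuous : {within A, continuous F} ;
  cfm_smooth : smooth_on_TM (nonzero_part A) F ;
  cfm_eq0 : forall v, A v -> (F v = 0 <-> vec v = 0) ;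
  cfm_homogeneous : forall (v : TM) (a : R),
    A v -> 0 < a -> F (tscale a v) = a * F v ;
  cfm_posdef : forall v, nonzero_part A v ->
    forall w : tangentSpace (base v), w != 0 -> 0 < fundamental_tensor F w w
}.

End conic_finsler.

(* Main.v *)
(* In a chart, the restriction f of a conic Finsler metric to a tangent space is
   positively homogeneous of degree 1 on an open cone, and
   g_v(u,w) = D_u f D_w f + f D_u D_w f at v.  Euler's relation D_v f = f and
   its derivatives D_v D_w f = D_w D_v f = 0 give g_v(v,w) = f D_w f and
   h_v(w,w) = f D_w D_w f, so the formula for g says that D_w and D_w D_w are
   additive in f.  For positivity: if w is not a multiple of v, then
   f_k D_w D_w f_k = g^k_v(w',w') > 0 where w' = w + a v is chosen with
   D_w' f_k = 0; if w = c v, then g_v(w,w) = c^2 F(v)^2. *)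
Require Import Defs.
From mathcomp Require Import all_boot all_order all_algebra.
From mathcomp Require Import all_classical all_reals all_analysis.

Set Implicit Arguments.
Unset Strict Implicit.
Unset Printing Implicit Defensive.

Import Order.TTheory GRing.Theory Num.Theory.
Import numFieldNormedType.Exports.

Local Open Scope classical_set_scope.
Local Open Scope ring_scope.

(** * Locality of differentiability, and finite sums of [Ck_on] maps *)

Section smooth_sum.
Variables (R : realType) (V W : normedModType R).

(** The difference [g - f] vanishes near [a], so it is differentiable there with zero differential;
    adding it to [f] gives [g]. *)
Lemma near_eq_differentiable (f g : V -> W) (a : V) :
  (\near a, f a = g a) -> differentiable f a -> differentiable g a.
Proof.
move=> fg df.
pose h := g - f.
have ha : \near a, h a = 0.
  by apply: filterS fg => x /= E; rewrite /h !fctE -E subrr.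
suff dh : differentiable h a.
  have -> : g = f + h by rewrite /h addrC subrK.
  exact: differentiableD.
have ho : h \o shift a = cst (h a) + (0 : V -> W) +o_ 0 id.
  have h0 : \forall x \near (0 : V), h (x + a) = 0.
    have : \forall x \near a, h x = 0 by exact: ha.
    rewrite (near_shift 0) /=; apply: filterS => x /=.
    by rewrite subr0.
  apply/eqaddoP => e e0; near=> x.
  have -> : (h \o shift a - (cst (h a) + (0 : V -> W))) x = 0.
    rewrite !fctE/= (nbhs_singleton ha) addr0 subr0.
    by near: x.
  by rewrite normr0 mulr_ge0// ltW.
have c0 : continuous (0 : V -> W) by move=> x; exact: cvg_cst.
have E := diff_unique (df := \0 : {linear V -> W}) c0 ho.
by apply/diff_locallyP; rewrite E.
Unshelve. all: by end_near. Qed.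

(** Openness of [U] passes agreement on to directional derivatives. This is needed because ['D_v] is
    known to commute with a sum only where the summands are differentiable. *)
Lemma Ck_on_eq (U : set V) : open U -> forall k (f g : V -> W),
  (forall x, U x -> f x = g x) -> Ck_on k U f -> Ck_on k U g.
Proof.
move=> oU; elim=> [|k IH] f g fg /=.
  by apply: subspace_eq_continuous => x; rewrite inE; exact: fg.
have nfg x : U x -> \near x, f x = g x.
  by move=> Ux; apply: filterS fg _; exact: open_nbhs_nbhs.
move=> [df Df]; split=> [x Ux|v].
  exact: near_eq_differentiable (nfg x Ux) (df x Ux).
by apply: IH (Df v) => x Ux; apply: near_eq_derive; exact: nfg.
Qed.

Lemma within_continuous_sum (T : topologicalType) (U : set T) n
    (f : 'I_n -> T -> W) :
  (forall i, {within U, continuous (f i)}) ->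
  {within U, continuous (fun x => \sum_(i < n) f i x)}.
Proof.
move=> cf x; apply: (cvg_big (op := +%R)); first exact: add_continuous.
by move=> i _; exact: cf.
Qed.

Lemma Ck_on_sum (U : set V) : open U -> forall k n (f : 'I_n -> V -> W),
  (forall i, Ck_on k U (f i)) -> Ck_on k U (\sum_(i < n) f i).
Proof.
move=> oU; elim=> [|k IH] n f.
  by move=> /= cf; rewrite fct_sumE; exact: within_continuous_sum.
move=> cf; split=> [x Ux|v].
  by apply: differentiable_sum => i; have [d _] := cf i; exact: d.
apply: (Ck_on_eq oU (f := \sum_(i < n) 'D_v (f i))).
  move=> x Ux; rewrite derive_sum ?fct_sumE// => i.
  by have [d _] := cf i; exact: diff_derivable (d x Ux).
by apply: IH => i; have [_] := cf i; exact.
Qed.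

End smooth_sum.

(** * Directional derivatives as one-variable derivatives along a line *)

Section directional_derivative.
Variables (R : realType) (V W : normedModType R).

(** Both sides are limits of the same difference quotient; this turns the iterated [derive1] of
    [fundamental_tensor] into directional derivatives. *)
Lemma derive1_line (f : V -> W) (a v : V) :
  derive1 (fun s : R => f (a + s *: v)) 0 = 'D_v f a.
Proof.
rewrite /derive1 /derive; set F := (X in lim (X @ _)).
set G := (X in _ = lim (X @ _)).
suff -> : F = G by [].
by apply/funext => h; rewrite /F /G /= addr0 scale0r addr0 [h *: v + a]addrC.
Qed.

Lemma derivable_line (f : V -> W) (a v : V) :
  derivable f a v -> derivable (fun s : R => f (a + s *: v)) 0 1.
Proof.
rewrite /derivable; set F := (X in cvg (X @ _)) => H.
set G := (X in cvg (X @ _)); suff -> : G = F by [].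
apply/funext => h; rewrite /F /G /= addr0 scale0r addr0 [h *: v + a]addrC.
by rewrite [h *: 1]mulr1.
Qed.

Lemma cvg_line (a v : V) : (fun s : R => a + s *: v) @ nbhs (0 : R) --> nbhs a.
Proof.
rewrite -[X in _ --> nbhs X]addr0 -(scale0r v).
by apply: cvgD; [exact: cvg_cst|apply: cvgZr_tmp; exact: cvg_id].
Qed.

End directional_derivative.

(** * Positively homogeneous functions on an open cone *)

Section homogeneous.
Variables (R : realType) (V : normedModType R).

(** What a conic Finsler metric retains on the nonzero vectors of one tangent space, read in a
    chart. Positive definiteness is left out, so that a sum qualifies before its own positivity is
    known. *)
Record homogeneous_C2 (U : set V) (f : V -> R^o) : Prop := HomogeneousC2 {
  hom_open : open U ;
  hom_cone : forall (a : R) x, 0 < a -> U x -> U (a *: x) ;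
  hom_eq : forall (a : R) x, 0 < a -> U x -> f (a *: x) = a * f x ;
  hom_diff : forall x, U x -> differentiable f x ;
  hom_diff2 : forall w x, U x -> differentiable ('D_w f) x
}.

Lemma homogeneous_C2_sum (U : set V) n (f : 'I_n -> V -> R^o) :
  open U -> (forall (a : R) x, 0 < a -> U x -> U (a *: x)) ->
  (forall k, homogeneous_C2 U (f k)) -> homogeneous_C2 U (\sum_(k < n) f k).
Proof.
move=> oU cU hf; split=> // [a x a0 Ux|x Ux|w x Ux].
- rewrite fct_sumE mulr_sumr; apply: eq_bigr => k _.
  exact: hom_eq (hf k) _ _ a0 Ux.
- by apply: differentiable_sum => k; exact: hom_diff (hf k) _ Ux.
- apply: (@near_eq_differentiable _ _ _ (\sum_(k < n) 'D_w (f k))).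
    apply: filterS (open_nbhs_nbhs (conj oU Ux)) => y Uy.
    rewrite derive_sum ?fct_sumE// => k.
    exact: diff_derivable (hom_diff (hf k) Uy).
  by apply: differentiable_sum => k; exact: hom_diff2 (hf k) _ _ Ux.
Qed.

Lemma derive2_sum (U : set V) n (f : 'I_n -> V -> R^o) u w x :
  (forall k, homogeneous_C2 U (f k)) -> open U -> U x ->
  'D_u ('D_w (\sum_(k < n) f k)) x = \sum_(k < n) 'D_u ('D_w (f k)) x.
Proof.
move=> hf oU Ux; rewrite -(derive_sum (h := fun k => 'D_w (f k))); last first.
  by move=> k; exact: diff_derivable (hom_diff2 (hf k) w Ux).
apply: near_eq_derive.
apply: filterS (open_nbhs_nbhs (conj oU Ux)) => y Uy.
rewrite derive_sum ?fct_sumE// => k.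
exact: diff_derivable (hom_diff (hf k) Uy).
Qed.

Variables (U : set V) (f : V -> R^o).
Hypothesis hf : homogeneous_C2 U f.

Let near_cone x : U x -> \forall y \near x, U y.
Proof. by move=> Ux; apply: open_nbhs_nbhs; split=> //; exact: hom_open hf. Qed.

Let dv x w : U x -> derivable f x w.
Proof. by move=> Ux; exact: diff_derivable (hom_diff hf Ux). Qed.

Let dv2 x u w : U x -> derivable ('D_w f) x u.
Proof. by move=> Ux; exact: diff_derivable (hom_diff2 hf w Ux). Qed.

(** Lets homogeneity apply to [x + s *: x] for small [s]. *)
Let near_dilation : \forall s \near (0 : R), 0 < 1 + s.
Proof.
have : \forall s \near (0 : R), -1 < s by apply: lt_nbhsr; rewrite ltrN10.
by apply: filterS => s; rewrite addrC -subr_gt0 opprK.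
Qed.

Lemma derive_linear x (a b : R) u w : U x ->
  'D_(a *: u + b *: w) f x = a * 'D_u f x + b * 'D_w f x.
Proof.
by move=> Ux; have d := hom_diff hf Ux; rewrite !deriveE// linearD !linearZ.
Qed.

Lemma derive2_linear x (a b : R) u w z : U x ->
  'D_(a *: u + b *: w) ('D_z f) x = a * 'D_u ('D_z f) x + b * 'D_w ('D_z f) x.
Proof.
by move=> Ux; have d := hom_diff2 hf z Ux; rewrite !deriveE// linearD !linearZ.
Qed.

Lemma derive2_sqr x u w : U x ->
  'D_u ('D_w (fun y => f y ^+ 2 : R^o)) x =
  2 * ('D_u f x * 'D_w f x + f x * 'D_u ('D_w f) x).
Proof.
move=> Ux.
have -> : 'D_u ('D_w (fun y => f y ^+ 2 : R^o)) x = 'D_u (2 *: (f * 'D_w f)) x.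
  apply: near_eq_derive; apply: filterS (near_cone Ux) => y Uy.
  rewrite (_ : (fun y => f y ^+ 2 : R^o) = f * f).
    by rewrite deriveM; [rewrite -mulr2n -scaler_nat|exact: dv..].
  by apply/funext => z; rewrite expr2.
rewrite deriveZ; last by apply: derivableM; [exact: dv|exact: dv2].
rewrite deriveM; [|exact: dv|exact: dv2].
by rewrite /GRing.scale/= addrC [X in X + _]mulrC.
Qed.

(** Along the ray through [x], [f] is the affine function [(1 + s) * f x] of [s], with slope
    [f x]. *)
Lemma euler x : U x -> 'D_x f x = f x.
Proof.
move=> Ux; rewrite -derive1_line derive1E.
have -> : 'D_1 (fun s : R => f (x + s *: x)) 0 =
          'D_1 (fun s : R => (1 + s) * f x : R^o) 0.
  apply: near_eq_derive.
  apply: filterS near_dilation => s s1.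
  by rewrite -{1}[x]scale1r -scalerDl (hom_eq hf).
rewrite (_ : (fun s => _) = (cst 1 + id) * cst (f x)); last exact/funext.
rewrite deriveM// deriveD// !derive_cst derive_id /= scaler0 !add0r.
by rewrite [LHS]mulr1.
Qed.

(** Differentiate [f (a *: x + s *: (a *: w)) = a * f (x + s *: w)] at [s = 0] and cancel [a]. *)
Lemma derive_scale x (a : R) w : 0 < a -> U x -> 'D_w f (a *: x) = 'D_w f x.
Proof.
move=> a0 Ux.
suff : a * 'D_w f (a *: x) = a * 'D_w f x.
  by move=> /(mulfI (lt0r_neq0 a0)).
have Uax := hom_cone hf a0 Ux.
transitivity ('D_(a *: w) f (a *: x)).
  by rewrite !deriveE ?linearZ//; exact: (hom_diff hf).
transitivity ('D_w (a *: f) x); last by rewrite deriveZ//; exact: dv.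
rewrite -!derive1_line !derive1E; apply: near_eq_derive.
have : \forall s \near (0 : R), U (x + s *: w).
  by apply: cvg_line; exact: near_cone.
apply: filterS => s Us; rewrite !fctE.
by rewrite scalerA mulrC -scalerA -scalerDr (hom_eq hf).
Qed.

(** By [derive_scale], ['D_w f] is constant along the ray through [x]. *)
Lemma derive2_radial_l x w : U x -> 'D_x ('D_w f) x = 0.
Proof.
move=> Ux; rewrite -derive1_line derive1E.
transitivity ('D_1 (cst ('D_w f x : R^o)) (0 : R)); last by rewrite derive_cst.
apply: near_eq_derive.
apply: filterS near_dilation => s s1.
by rewrite -{1}[x]scale1r -scalerDl derive_scale.
Qed.

(* Differentiating Euler's relation [D_y f y = f y] in [y] avoids the symmetry
   of second derivatives. *)
Lemma derive2_radial_r x w : U x -> 'D_w ('D_x f) x = 0.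
Proof.
move=> Ux; rewrite -derive1_line derive1E.
pose F s : R^o := f (x + s *: w); pose G s : R^o := 'D_w f (x + s *: w).
have dF : derivable F 0 1 by exact: derivable_line (dv Ux).
have dG : derivable G 0 1 by exact: (derivable_line (dv2 Ux)).
(* At [y = x + s *: w] one has [x = y - s *: w], so Euler's relation gives
   ['D_x f y = F s - s * G s], whose derivative at 0 is ['D_w f x - 'D_w f x]. *)
transitivity ('D_1 (F - id * G) (0 : R)).
  apply: near_eq_derive.
  have : \forall s \near (0 : R), U (x + s *: w).
    by apply: cvg_line; exact: near_cone.
  apply: filterS => s Us; have := derive_linear 1 s x w Us.
  by rewrite scale1r mul1r (euler Us) !fctE /F /G => ->; rewrite addrK.
rewrite deriveB//; last exact: derivableM.
rewrite deriveM// derive_id scale0r add0r /G scale0r addr0 -!derive1E.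
by rewrite derive1_line [_ *: 1]mulr1 subrr.
Qed.

Lemma derive_collinear x (c : R) : U x -> 'D_(c *: x) f x = c * f x.
Proof.
move=> Ux; have d := hom_diff hf Ux.
by rewrite deriveE// linearZ -deriveE// euler.
Qed.

Lemma derive2_collinear x (c : R) : U x -> 'D_(c *: x) ('D_(c *: x) f) x = 0.
Proof.
move=> Ux; have d := hom_diff2 hf (c *: x) Ux.
rewrite deriveE// linearZ -deriveE// derive2_radial_l//; exact: mulr0.
Qed.

(** In the bilinear expansion, every term other than ['D_w ('D_w f) x] has the radial direction [x]
    in some slot and vanishes. *)
Lemma derive2_shear x (a : R) w : U x ->
  'D_(w + a *: x) ('D_(w + a *: x) f) x = 'D_w ('D_w f) x.
Proof.
move=> Ux.
transitivity ('D_(w + a *: x) ('D_w f + a *: 'D_x f) x).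
  apply: near_eq_derive; apply: filterS (near_cone Ux) => y Uy.
  by rewrite -{1}[w]scale1r derive_linear// mul1r.
rewrite deriveD ?deriveZ; [|exact: dv2..|apply: derivableZ; exact: dv2].
have E z := derive2_linear 1 a w x z Ux; rewrite scale1r in E.
rewrite !E !derive2_radial_l// derive2_radial_r// !mulr0 !addr0 !mul1r.
by rewrite [a *: 0]mulr0 addr0.
Qed.

(* Adding to [w] the multiple of [x] that kills ['D_w f x] leaves
   ['D_w ('D_w f) x] unchanged. *)
Lemma derive2_gt0 x w : U x -> 0 < f x ->
  (forall u, u != 0 -> 0 < 'D_u f x ^+ 2 + f x * 'D_u ('D_u f) x) ->
  (forall c : R, w != c *: x) -> 0 < 'D_w ('D_w f) x.
Proof.
move=> Ux f0 pd wx; pose a := - ('D_w f x / f x).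
rewrite -(derive2_shear a w Ux).
have := pd (w + a *: x); rewrite addr_eq0 -scaleNr wx => /(_ isT).
rewrite (_ : 'D_(w + a *: x) f x = 0).
  by rewrite expr0n/= add0r pmulr_rgt0.
rewrite -{1}[w]scale1r derive_linear// euler// mul1r /a.
by rewrite mulNr divfK ?subrr// gt_eqF.
Qed.

End homogeneous.

(** * Restriction of a metric to one tangent space, in a chart *)

Section fibre.
Variables (R : realType) (m : nat) (M : smoothManifold R m).
Local Notation TM := (tangentBundle M).
Implicit Types (A : set TM) (F : TM -> R).

(** In each bundle chart, a vector is zero exactly when its coordinate vector is, so the image of
    [A] is cut by the open condition [z.2 != 0]. *)
Lemma open_nonzero_part A : open A -> open (nonzero_part A).
Proof.
move=> oA; suff : tangent_open (nonzero_part A) by [].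
move=> i; rewrite tchart_image.
have -> : [set z | (chart i @` dom i) z.1 /\ nonzero_part A (tchart_inv i z)] =
    tchart i @` (A `&` @tdom _ _ M i) `&` [set z | z.2 != 0].
  rewrite tchart_image; apply/seteqP; split=> -[x y] /=.
    move=> [ix [Axy xy0]]; split; first by split.
    apply: contra_neq xy0 => ->; apply: val_inj; apply/funext => j /=.
    by rewrite /coord_family; case: asboolP => // _; rewrite linear0.
  move=> [[ix Axy] y0]; split=> //; split=> //; apply: contra_neq y0 => xy0.
  have [p ip px] := ix.
  have iq : dom i (chart_inv i x) by rewrite -px chartK.
  by rewrite -(tangent_of_coordK y iq) [tangent_of_coord _ _ _]xy0.
apply: openI; first by move: i; exact: (oA : tangent_open A).
rewrite (_ : [set z | _] = snd @^-1` (~` [set 0])); last first.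
  by apply/seteqP; split=> z /= /eqP.
apply: open_comp; first by move=> z _; exact: cvg_snd.
apply: closed_openC.
exact/accessible_closed_set1/hausdorff_accessible/norm_hausdorff.
Qed.

Lemma tchart_invZ i (x y : 'rV[R]_m) (a : R) :
  @tchart_inv _ _ M i (x, a *: y) = tscale a (tchart_inv i (x, y)).
Proof.
congr TVec; apply: val_inj; apply/funext => j.
change (coord_family i (chart_inv i x) (a *: y) j =
  a *: coord_family i (chart_inv i x) y j).
by rewrite /coord_family; case: asboolP => _; rewrite ?linearZ ?scaler0.
Qed.

Variables (i : atlas M) (p : M).
Hypothesis ip : dom i p.

Definition fibre_point (y : 'rV[R]_m) : TM := tchart_inv i (chart i p, y).

Definition fibre_map F (y : 'rV[R]_m) : R^o := F (fibre_point y).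

Lemma fibre_point_tcoord (u : tangentSpace p) :
  fibre_point (tcoord u i) = TVec u.
Proof. exact: (@tchartK _ _ M i (TVec u) ip). Qed.

(** Smoothness carries over by composing [F], read in the bundle chart, with the embedding
    [y |-> (chart i p, y)]; the derivative along [w] becomes the one in the vertical direction
    [(0, w)]. *)
Lemma fibre_homogeneous_C2 A F : conic_finsler_metric A F ->
  homogeneous_C2 (fibre_point @^-1` nonzero_part A) (fibre_map F).
Proof.
case=> -[oA _ coneA] _ _ smF _ homF _.
pose O := tchart i @` (nonzero_part A `&` @tdom _ _ M i).
pose pt (y : 'rV[R]_m) := (chart i p, y).
have OE : fibre_point @^-1` nonzero_part A = pt @^-1` O.
  rewrite /O tchart_image; apply/seteqP; split=> y /=; last by case.
  by move=> ?; split=> //; exists p.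
have dpt y : differentiable pt y.
  by apply: differentiable_pair.
have D1 w : 'D_w (fibre_map F) = 'D_(0, w) (F \o tchart_inv i : _ -> R^o) \o pt.
  apply/funext => y; rewrite /= -!derive1_line; congr (derive1 _ _).
  apply/funext => s; congr F; congr (tchart_inv i _); congr (_, _).
  by rewrite /= scaler0 addr0.
split.
- rewrite OE; apply: open_comp; last exact: open_nonzero_part.
  by move=> y _; exact: differentiable_continuous.
- move=> a y a0 [Ay y0]; rewrite /= /fibre_point tchart_invZ.
  split; first exact: coneA.
  by rewrite /= scaler_eq0 negb_or gt_eqF.
- move=> a y a0 [Ay y0]; rewrite /fibre_map /fibre_point tchart_invZ.
  exact: homF.
- rewrite OE => y Oy; have [d _] := smF i 1%N.
  exact: (differentiable_comp (dpt y) (d _ Oy)).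
- rewrite OE => w y Oy; rewrite D1; have [_ /(_ (0, w))[d _]] := smF i 2%N.
  exact: (differentiable_comp (dpt y) (d _ Oy)).
Qed.

End fibre.

Lemma tcoord_inj (R : realType) (m : nat) (M : smoothManifold R m)
    (i : atlas M) (p : M) (u w : tangentSpace p) :
  dom i p -> tcoord u i = tcoord w i -> u = w.
Proof.
case: u w => c cP [d dP] ip /= cd; apply: val_inj; apply/funext => j /=.
have /asboolP[c0 cE] := cP; have /asboolP[d0 dE] := dP.
have [jp|jp] := pselect (dom j p); first by rewrite (cE i)// (dE i)// cd.
by rewrite c0// d0.
Qed.

(** * Fundamental tensor and angular metric in coordinates *)

Section tensor.
Variables (R : realType) (m : nat) (M : smoothManifold R m).
Local Notation TM := (tangentBundle M).
Variables (A : set TM) (v : TM) (i : atlas M).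
Hypotheses (iv : dom i (base v)) (Av : nonzero_part A v).

Local Notation U := (fibre_point i (base v) @^-1` nonzero_part A).
Local Notation y := (tcoord (vec v) i).

Lemma fibre_domain : U y.
Proof. by rewrite /= fibre_point_tcoord//; case: v Av. Qed.

Lemma fibre_mapE (F : TM -> R) : fibre_map i (base v) F y = F v.
Proof. by rewrite /fibre_map fibre_point_tcoord//; case: v. Qed.

Variable F : TM -> R.
Local Notation f := (fibre_map i (base v) F).
Hypothesis hf : homogeneous_C2 U f.
Implicit Types u w : tangentSpace (base v).

Lemma fundamental_tensorE u w : fundamental_tensor F u w =
  'D_(tcoord u i) f y * 'D_(tcoord w i) f y
  + F v * 'D_(tcoord u i) ('D_(tcoord w i) f) y.
Proof.
transitivity
    (2^-1 * 'D_(tcoord u i) ('D_(tcoord w i) (fun z => f z ^+ 2 : R^o)) y).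
  rewrite -derive1_line /fundamental_tensor; congr (_ * _).
  set g1 := (X in derive1 X 0 = _); set g2 := (X in _ = derive1 X 0).
  suff -> : g1 = g2 by [].
  apply/funext => t; rewrite /g1 /g2 -derive1_line.
  set h1 := (X in derive1 X 0 = _); set h2 := (X in _ = derive1 X 0).
  suff -> : h1 = h2 by [].
  apply/funext => s; rewrite /h1 /h2 /fibre_map.
  (* Tangent vectors are added and scaled chart by chart, so taking coordinates commutes with the
     perturbation by [t] and [s]. *)
  by rewrite -(fibre_point_tcoord iv (vec v + t *: u + s *: w)).
by rewrite (derive2_sqr hf _ _ fibre_domain) mulKf ?pnatr_eq0// fibre_mapE.
Qed.

Lemma fundamental_tensor_radial w :
  fundamental_tensor F (vec v) w = F v * 'D_(tcoord w i) f y.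
Proof.
rewrite fundamental_tensorE (euler hf fibre_domain).
by rewrite (derive2_radial_l hf _ fibre_domain) mulr0 addr0 fibre_mapE.
Qed.

(** The square of ['D_w f] in [g_v(w,w)] cancels against [g_v(v,w)^2 / F(v)^2]. *)
Lemma angular_metricE w : F v != 0 ->
  angular_metric F w = F v * 'D_(tcoord w i) ('D_(tcoord w i) f) y.
Proof.
move=> F0.
rewrite /angular_metric fundamental_tensor_radial fundamental_tensorE.
by rewrite exprMn mulKf ?expf_neq0// expr2 addrAC subrr add0r.
Qed.

End tensor.

(** * Sums of conic Finsler metrics *)

Theorem corollary4p3 (R : realType) (m : nat) (M : smoothManifold R m)
    (n : nat) (n_gt0 : (0 < n)%N)
    (A : set (tangentBundle M)) (Fk : 'I_n -> tangentBundle M -> R)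
    (Fk_finsler : forall k, conic_finsler_metric A (Fk k)) :
  let F := fun v : tangentBundle M => \sum_(k < n) Fk k v in
  conic_finsler_metric A F /\
  forall v : tangentBundle M, nonzero_part A v ->
  forall w : tangentSpace (base v),
    fundamental_tensor F w w =
      F v * (\sum_(k < n) angular_metric (Fk k) w / Fk k v)
      + (\sum_(k < n) fundamental_tensor (Fk k) (vec v) w / Fk k v) ^+ 2.
Proof.
(* One summand supplies the conic domain, makes a sum of positive terms strictly positive, and
   forces [vec v = 0] when the sum vanishes. *)
move=> F; pose k0 := Ordinal n_gt0.
have domA := cfm_domain (Fk_finsler k0); have [oA _ _] := domA.
have sum_gt0 (a : 'I_n -> R) : (forall k, 0 < a k) -> 0 < \sum_(k < n) a k.
  move=> a0; rewrite (bigD1 k0)//= ltr_wpDr// sumr_ge0// => k _.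
  exact: ltW.
have Fk_gt0 v k : nonzero_part A v -> 0 < Fk k v.
  move=> [Av v0]; rewrite lt_neqAle (cfm_ge0 (Fk_finsler k))// andbT eq_sym.
  by apply: contra_neq v0; apply: (cfm_eq0 (Fk_finsler k) Av).1.
have hk v i k (iv : dom i (base v)) :=
  fibre_homogeneous_C2 iv (Fk_finsler k).
have FE i p : fibre_map i p F = \sum_(k < n) fibre_map i p (Fk k).
  by rewrite fct_sumE.
have hF v i : dom i (base v) ->
    homogeneous_C2 (fibre_point i (base v) @^-1` nonzero_part A)
      (fibre_map i (base v) F).
  move=> iv; rewrite FE; apply: homogeneous_C2_sum.
  - exact: hom_open (hk v i k0 iv).
  - exact: hom_cone (hk v i k0 iv).
  - by move=> k; exact: hk.
have D1 v i u : dom i (base v) -> nonzero_part A v ->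
    'D_u (fibre_map i (base v) F) (tcoord (vec v) i) =
    \sum_(k < n) 'D_u (fibre_map i (base v) (Fk k)) (tcoord (vec v) i).
  move=> iv Av; rewrite FE derive_sum// => k.
  exact: diff_derivable (hom_diff (hk v i k iv) (fibre_domain iv Av)).
have D2 v i u : dom i (base v) -> nonzero_part A v ->
    'D_u ('D_u (fibre_map i (base v) F)) (tcoord (vec v) i) =
    \sum_(k < n) 'D_u ('D_u (fibre_map i (base v) (Fk k))) (tcoord (vec v) i).
  move=> iv Av; rewrite FE (derive2_sum _ _ (fun k => hk v i k iv))//.
    exact: hom_open (hk v i k0 iv).
  exact: fibre_domain.
split; last first.
  move=> v Av w; have [i iv] := dom_cover (base v).
  rewrite (fundamental_tensorE iv Av (hF v i iv)) -expr2 D1// D2// addrC.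
  (* Termwise, [h^k_v(w,w) / F_k(v)] is the second and [g^k_v(v,w) / F_k(v)] the first derivative of
     the k-th fibre map along [w]. *)
  congr (_ * _ + _ ^+ 2); apply: eq_bigr => k _.
    rewrite (angular_metricE iv Av (hk v i k iv)) ?gt_eqF ?Fk_gt0//.
    by rewrite mulrC mulKf// gt_eqF// Fk_gt0.
  rewrite (fundamental_tensor_radial iv Av (hk v i k iv)).
  by rewrite mulrC mulKf// gt_eqF// Fk_gt0.
split=> //.
- by move=> v Av; apply: sumr_ge0 => k _; exact: cfm_ge0 (Fk_finsler k) _ Av.
- apply: (@within_continuous_sum R R^o) => k.
  exact: cfm_continuous (Fk_finsler k).
- move=> i k.
  rewrite (_ : F \o _ = \sum_(j < n) (Fk j \o @tchart_inv _ _ M i : _ -> R^o)).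
    apply: Ck_on_sum; first exact: open_nonzero_part oA i.
    by move=> j; exact: cfm_smooth (Fk_finsler j) i k.
  by rewrite fct_sumE.
- move=> v Av; split=> [|v0].
    move=> /eqP; rewrite psumr_eq0 => [/allP/(_ k0 (mem_index_enum _))/eqP|k _].
      exact: (cfm_eq0 (Fk_finsler k0) Av).1.
    exact: cfm_ge0 (Fk_finsler k) _ Av.
  by apply: big1 => k _; exact: (cfm_eq0 (Fk_finsler k) Av).2.
- move=> v a Av a0; rewrite mulr_sumr; apply: eq_bigr => k _.
  exact: cfm_homogeneous (Fk_finsler k) _ _ Av a0.
move=> v Av w w0; have [i iv] := dom_cover (base v).
have Uy := fibre_domain iv Av.
have Fv0 : 0 < F v by apply: sum_gt0 => k; exact: Fk_gt0.
rewrite (fundamental_tensorE iv Av (hF v i iv)) -expr2.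
have wi0 : tcoord w i != 0.
  by apply: contra_neq w0 => wi0; apply: (tcoord_inj iv).
have [[c wc]|wc] := pselect (exists c : R, tcoord w i = c *: tcoord (vec v) i).
  rewrite wc (derive2_collinear (hF v i iv))// mulr0 addr0.
  rewrite (derive_collinear (hF v i iv))// fibre_mapE// exprn_even_gt0//=.
  apply: mulf_neq0; last by rewrite gt_eqF.
  by apply: contra_neq wi0 => c0; rewrite wc c0 scale0r.
rewrite ltr_wpDl ?sqr_ge0// mulr_gt0// D2//; apply: sum_gt0 => k.
apply: (derive2_gt0 (hk v i k iv) Uy).
- by rewrite fibre_mapE// Fk_gt0.
(* Each coordinate vector [u] comes from a tangent vector [z], to which positive definiteness of the
   k-th metric applies. *)
- move=> u u0; pose z := tangent_of_coord i (base v) u.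
  have zu : tcoord z i = u by exact: tangent_of_coordK.
  have z0 : z != 0 by apply: contra_neq u0 => z0; rewrite -zu z0.
  have := cfm_posdef (Fk_finsler k) Av z0.
  by rewrite (fundamental_tensorE iv Av (hk v i k iv)) zu -expr2 fibre_mapE.
- by move=> c; apply/eqP => wcE; apply: wc; exists c.
Qed.
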